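(* Let $G$ be a finite simple graph. Then $G$ is a color-line graph if and only if there exists a family $\mathcal{Q}$ of cliques of $G$ such that (a) every vertex of $G$ belongs to at most three members of $\mathcal{Q}$, and every edge of $G$ belongs to at least one and at most two members of $\mathcal{Q}$; (b) letting $F\subseteq E(G)$ be the set of edges of $G$ belonging to exactly two members of $\mathcal{Q}$ and $W\subseteq V(G)$ the set of vertices of $G$ belonging to exactly three members of $\mathcal{Q}$, there exist mappings $F\to\mathcal{Q}$, $e\mapsto Q_e$, and $W\to\mathcal{Q}$, $v\mapsto Q_v$, such that (b1) for all $x\in F\cup W$, $x\in Q_x$, and (b2) for all $x,y\in F\cup W$: if $x\in Q_y$ then $Q_x=Q_y$, and if $x\notin Q_y$ then $Q_x\cap Q_y=\emptyset$.
   Context: All graphs are finite and simple. An edge coloring of a graph $H$ is a map $\phi:E(H)\to\mathcal{C}$ into a set of colors; it is proper if any two distinct edges sharing an endvertex get different colors. For an edge-colored graph $(H,\phi)$, the color-line graph $\mathrm{CL}(H)$ has vertex set $E(H)$, two distinct vertices being adjacent iff the corresponding edges of $H$ share an endvertex or have the same color. A graph $G$ is a color-line graph if it is isomorphic to $\mathrm{CL}(H)$ for some edge-colored graph $H$. A clique is a set of pairwise adjacent vertices. An edge $e=uv$ ''belongs to'' (or ''is in'') a clique $Q$ if $u,v\in Q$; a vertex belongs to $Q$ if it is an element of $Q$. For an edge $x$, ''$x\in Q$'' means both endpoints of $x$ lie in $Q$. *)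

(* Defs.v *)
From mathcomp Require Import all_boot.
Set Implicit Arguments.
Unset Strict Implicit.
Unset Printing Implicit Defensive.

Record sgraph := SGraph {
  vert :> finType;
  adj : rel vert;
  adj_sym : symmetric adj;
  adj_irrefl : irreflexive adj }.

Definition edge_set (G : sgraph) : {set {set G}} :=
  [set [set p.1; p.2] | p : G * G & adj p.1 p.2].

Definition edge (G : sgraph) := {e : {set G} | e \in edge_set G}.

Definition isomorphic (G H : sgraph) : Prop :=
  exists2 f : G -> H, bijective f & forall u v : G, adj (f u) (f v) = adj u v.

Section ColorLineGraph.
Variables (H : sgraph) (C : eqType) (phi : edge H -> C).

Definition share_endvertex (e f : edge H) : bool :=
  [exists v : H, (v \in val e) && (v \in val f)].

Definition CL_adj : rel (edge H) :=
  fun e f => (e != f) && (share_endvertex e f || (phi e == phi f)).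

Lemma CL_adj_sym : symmetric CL_adj.
Proof.
move=> e f; rewrite /CL_adj eq_sym [phi f == _]eq_sym; congr (_ && (_ || _)).
by apply: eq_existsb => v; rewrite andbC.
Qed.

Lemma CL_adj_irrefl : irreflexive CL_adj.
Proof. by move=> e; rewrite /CL_adj eqxx. Qed.

Definition CL : sgraph := SGraph CL_adj_sym CL_adj_irrefl.

End ColorLineGraph.

(* The coloring is arbitrary, not necessarily proper. *)
Definition color_line_graph (G : sgraph) : Prop :=
  exists (H : sgraph) (C : eqType) (phi : edge H -> C), isomorphic G (CL phi).

Definition is_clique (G : sgraph) (Q : {set G}) : Prop :=
  {in Q &, forall u v, u != v -> adj u v}.

(* Disjoint sum of E(G) and V(G): lets one variable range over edges and vertices. *)
Definition item (G : sgraph) : finType := (edge G + G)%type.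

Definition belongs (G : sgraph) (x : item G) (Q : {set G}) : bool :=
  match x with
  | inl e => val e \subset Q
  | inr v => v \in Q
  end.

Section Families.
Variables (G : sgraph) (QQ : {set {set G}}).

Definition multiplicity (x : item G) : nat :=
  #|[set Q in QQ | belongs x Q]|.

Definition doubled_edges : {set edge G} :=
  [set e | multiplicity (inl e) == 2].

Definition tripled_vertices : {set G} :=
  [set v | multiplicity (inr v) == 3].

Definition doubled_or_tripled (x : item G) : bool :=
  match x with
  | inl e => e \in doubled_edges
  | inr v => v \in tripled_vertices
  end.

End Families.

(* x |-> Q_x on edges and vertices, glued from e |-> Q_e and v |-> Q_v. *)
Definition assigned (G : sgraph) (QF : edge G -> {set G}) (QW : G -> {set G})
    (x : item G) : {set G} :=
  match x with
  | inl e => QF e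
  | inr v => QW v
  end.

(* Main.v *)
Require Import Defs.
From mathcomp Require Import all_boot.

Set Implicit Arguments.
Unset Strict Implicit.
Unset Printing Implicit Defensive.

(** A Krausz-type argument.  In [CL(H)] the stars and the color classes of [H]
    are cliques covering all edges; a color class is assigned to every item of
    maximal multiplicity, and color classes are pairwise disjoint.  Conversely,
    the assigned members of the family are pairwise disjoint and serve as color
    classes.  Discarding them leaves every vertex of [G] in at most two cliques
    and every edge in at most one, so the remaining cliques are the vertices of
    a root graph in which a vertex of [G] joins the cliques containing it, padded
    with private endvertices when there are fewer than two. *)

(** * Edges as two-element sets *)

Lemma edge_setP (G : sgraph) (e : {set G}) :
  reflect (exists u v, adj u v /\ e = [set u; v]) (e \in edge_set G).
Proof.
apply: (iffP imsetP) => [[[u v] /= uv ->]|[u [v [uv ->]]]].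
  by exists u, v; rewrite inE in uv.
by exists (u, v); rewrite ?inE.
Qed.

Lemma adj_neq (G : sgraph) (u v : G) : adj u v -> u != v.
Proof. by apply: contraTneq => ->; rewrite adj_irrefl. Qed.

(** * Color-line graphs as assignments of endpoint pairs and colors *)

Section Representation.
Variables (G : sgraph) (T : finType) (C : eqType).
Variables (ends : G -> {set T}) (c : G -> C).

(** Encodes an edge-colored root graph without a bijection of types: [ends u] is the pair of
    endpoints of the root edge that corresponds to [u]. Injectivity excludes parallel edges and
    cardinality two excludes loops. *)
Definition represents : Prop :=
  [/\ injective ends, forall u, #|ends u| = 2 &
      forall u v, adj u v =
        (u != v) && ((ends u :&: ends v != set0) || (c u == c v))].

End Representation.

Section RootGraph.
Variables (G : sgraph) (T : finType) (ends : G -> {set T}).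
Hypothesis card_ends : forall u, #|ends u| = 2.

Definition root_adj : rel T :=
  fun x y => (x != y) && [exists u, ends u == [set x; y]].

Lemma root_adj_sym : symmetric root_adj.
Proof.
by move=> x y; rewrite /root_adj eq_sym; congr andb; apply: eq_existsb => u; rewrite setUC.
Qed.

Lemma root_adj_irrefl : irreflexive root_adj.
Proof. by move=> x; rewrite /root_adj eqxx. Qed.

Definition root_graph : sgraph := SGraph root_adj_sym root_adj_irrefl.

Lemma ends_edge (u : G) : ends u \in edge_set root_graph.
Proof.
have /cards2P[x [y [xy def_u]]] : #|ends u| == 2 by rewrite card_ends.
apply/edge_setP; exists x, y; split=> //=.
by rewrite /root_adj xy; apply/existsP; exists u; rewrite def_u.
Qed.

Lemma edge_ends (e : edge root_graph) : exists u, ends u == val e.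
Proof.
have /edge_setP[x [y [/andP[_ /existsP[u /eqP def_u]] ->]]] := valP e.
by exists u; rewrite def_u.
Qed.

End RootGraph.

(** A simple graph is recovered from its set of endpoint pairs, and the edges of [root_graph ends]
    are exactly the values of [ends]. Both directions of the theorem can therefore work with pairs
    and colors only. *)
Lemma color_line_graphP (G : sgraph) :
  color_line_graph G <->
  exists (T : finType) (C : eqType) (ends : G -> {set T}) (c : G -> C),
    represents ends c.
Proof.
split=> [[H [C [phi [f [g fK gK] fadj]]]]|[T [C [ends [c [inj card adjE]]]]]].
  exists H, C, (fun u => val (f u)), (fun u => phi (f u)); split.
  - by move=> u v /val_inj/(can_inj fK).
  - move=> u; have /edge_setP[x [y [/adj_neq xy ->]]] := valP (f u).
    by rewrite cards2 xy.
  - move=> u v; rewrite -fadj /= /CL_adj (inj_eq (can_inj fK)).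
    congr (_ && (_ || _)); apply/existsP/set0Pn => -[x].
      by move=> Hx; exists x; rewrite inE.
    by rewrite inE => Hx; exists x.
(* The preimage of [e] is picked by choice; injectivity of [ends] makes it unique, so [g] inverts
   [f]. *)
pose g (e : edge (root_graph ends)) : G := xchoose (edge_ends e).
pose f (u : G) : edge (root_graph ends) := exist _ (ends u) (ends_edge card u).
have gE e : ends (g e) = val e by apply/eqP/(xchooseP (edge_ends e)).
have fK : cancel f g by move=> u; apply: inj; rewrite gE.
have gK : cancel g f by move=> e; apply: val_inj; rewrite /= gE.
exists (root_graph ends), C, (fun e => c (g e)), f; first by exists g.
move=> u v; rewrite adjE /= /CL_adj !fK (inj_eq (can_inj fK)).
congr (_ && (_ || _)); apply/existsP/set0Pn => -[x].
  by move=> Hx; exists x; rewrite inE.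
by rewrite inE => Hx; exists x.
Qed.

(** Reduces statements on edges and vertices alike to a single vertex, so that disjointness of
    cliques applies to both kinds of item. *)
Lemma belongs_nonempty (G : sgraph) (x : item G) :
  exists u, forall Q : {set G}, belongs x Q -> u \in Q.
Proof.
case: x => [e|v] /=; last by exists v.
have /edge_setP[u [v [_ ->]]] := valP e.
by exists u => Q /subsetP; apply; rewrite !inE eqxx.
Qed.

(** * From a root graph to the cliques: stars and color classes *)

Section CliquesOfRepresentation.
Variables (G : sgraph) (T : finType) (C : eqType).
Variables (ends : G -> {set T}) (c : G -> C).
Hypothesis repr : represents ends c.

Definition star (t : T) : {set G} := [set u | t \in ends u].
Definition color_class (u : G) : {set G} := [set v | c v == c u].
Definition stars : {set {set G}} := [set star t | t : T].
Definition color_classes : {set {set G}} := [set color_class u | u : G].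
Definition root_cliques : {set {set G}} := stars :|: color_classes.

Lemma color_classes_disjoint (Q R : {set G}) (u : G) :
  Q \in color_classes -> R \in color_classes -> u \in Q -> u \in R -> Q = R.
Proof.
case/imsetP=> q _ -> /imsetP[r _ ->]; rewrite !inE => /eqP uq /eqP ur.
by apply/setP=> v; rewrite !inE -uq ur.
Qed.

Lemma root_cliques_clique (Q : {set G}) : Q \in root_cliques -> is_clique Q.
Proof.
have [_ _ adjE] := repr.
case/setUP=> /imsetP[t _ ->] u v; rewrite !inE => Hu Hv uv; rewrite adjE uv /=.
  by apply/orP; left; apply/set0Pn; exists t; rewrite inE Hu.
by rewrite (eqP Hu) (eqP Hv) eqxx orbT.
Qed.

Lemma color_multiplicity (x : item G) : multiplicity color_classes x <= 1.
Proof.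
have [u xu] := belongs_nonempty x.
apply/card_le1_eqP=> Q R; rewrite !inE => /andP[HQ xQ] /andP[HR xR].
by apply: (color_classes_disjoint HR HQ (xu _ xR) (xu _ xQ)).
Qed.

Lemma star_vertex_multiplicity (v : G) : multiplicity stars (inr v) <= 2.
Proof.
have [_ card_ends _] := repr.
rewrite -(card_ends v); apply: leq_trans (leq_imset_card star _).
apply/subset_leq_card/subsetP=> Q; rewrite inE /= => /andP[/imsetP[t _ ->]].
by rewrite inE => tv; apply: imset_f.
Qed.

(** A star containing both ends [u], [v] of [e] is centered at a common element of [ends u] and
    [ends v]. Two such elements would force [ends u = ends v], against injectivity. *)
Lemma star_edge_multiplicity (e : edge G) : multiplicity stars (inl e) <= 1.
Proof.
have [inj card_ends _] := repr.
have /edge_setP[u [v [/adj_neq uv def_e]]] := valP e.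
have: #|ends u :&: ends v| <= 1.
  rewrite leqNgt; apply: contra uv => ge2; apply/eqP/inj.
  have Iu : ends u :&: ends v = ends u.
    by apply/eqP; rewrite eqEcard subsetIl card_ends.
  by apply/eqP; rewrite eqEcard !card_ends leqnn andbT; apply/setIidPl.
apply: leq_trans; apply: leq_trans (leq_imset_card star _).
apply/subset_leq_card/subsetP=> Q; rewrite inE /= => /andP[/imsetP[t _ ->]].
rewrite def_e => /subsetP sub_e; apply: imset_f.
by have := sub_e u; have := sub_e v; rewrite !inE !eqxx orbT => -> // ->.
Qed.

(** Only an inequality: a star and a color class may be the same set, which is then counted once. *)
Lemma root_multiplicity (x : item G) :
  multiplicity root_cliques x <= multiplicity stars x + multiplicity color_classes x.
Proof.
rewrite /multiplicity /root_cliques !setIdE setIUl.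
by rewrite cardsU leq_subr.
Qed.

(** Stars alone contribute at most one to an edge and two to a vertex, so maximal multiplicity needs
    a color class. *)
Lemma colored_item (x : item G) :
  doubled_or_tripled root_cliques x ->
  exists Q, (Q \in color_classes) && belongs x Q.
Proof.
move=> Fx; suff: 0 < multiplicity color_classes x.
  by case/card_gt0P=> Q; rewrite inE; exists Q.
have := root_multiplicity x; rewrite lt0n; apply: contraL => /eqP->.
rewrite addn0 -ltnNge; case: x Fx => [e|v]; rewrite /= inE => /eqP->.
  exact: star_edge_multiplicity.
exact: star_vertex_multiplicity.
Qed.

Lemma root_edge_covered (e : edge G) : 0 < multiplicity root_cliques (inl e).
Proof.
have [_ _ adjE] := repr.
have /edge_setP[u [v [uv def_e]]] := valP e.
suff [Q HQ [uQ vQ]] : exists2 Q, Q \in root_cliques & u \in Q /\ v \in Q.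
  by apply/card_gt0P; exists Q; rewrite inE HQ /= def_e subUset !sub1set uQ.
move: uv; rewrite adjE => /andP[_ /orP[/set0Pn[t]|cuv]].
  rewrite inE => /andP[tu tv]; exists (star t); last by rewrite !inE.
  by rewrite inE imset_f.
exists (color_class v); last by rewrite !inE cuv eqxx.
by rewrite inE [X in _ || X]imset_f ?orbT.
Qed.

(** The default [set0] is never reached on items of maximal multiplicity. *)
Definition color_of_item (x : item G) : {set G} :=
  odflt set0 [pick Q in color_classes | belongs x Q].

Lemma color_of_itemP (x : item G) :
  doubled_or_tripled root_cliques x ->
  (color_of_item x \in color_classes) && belongs x (color_of_item x).
Proof.
move=> /colored_item[Q HQ]; rewrite /color_of_item.
by case: pickP => [R ->|/(_ Q)] //; rewrite HQ.
Qed.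

End CliquesOfRepresentation.

(** * From the cliques to a root graph *)

Section RootOfCliques.
Variables (G : sgraph) (QQ : {set {set G}}) (q : item G -> {set G}).
Hypothesis clique : forall Q : {set G}, Q \in QQ -> is_clique Q.
Hypothesis vertex_le3 : forall v : G, multiplicity QQ (inr v) <= 3.
Hypothesis edge_mult : forall e : edge G, 1 <= multiplicity QQ (inl e) <= 2.
Hypothesis q_in : forall x, doubled_or_tripled QQ x -> q x \in QQ.
Hypothesis q_belongs : forall x, doubled_or_tripled QQ x -> belongs x (q x).
Hypothesis q_trivI : forall x y : item G,
  doubled_or_tripled QQ x -> doubled_or_tripled QQ y ->
  (belongs x (q y) -> q x = q y) /\ (~~ belongs x (q y) -> q x :&: q y = set0).

Definition color_cliques : {set {set G}} :=
  [set q x | x : item G & doubled_or_tripled QQ x].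
Definition vertex_cliques : {set {set G}} := QQ :\: color_cliques.

Lemma color_cliques_sub (Q : {set G}) : Q \in color_cliques -> Q \in QQ.
Proof. by case/imsetP=> x; rewrite inE => Fx ->; apply: q_in. Qed.

Lemma color_cliques_trivI : trivIset color_cliques.
Proof.
apply/trivIsetP=> Q R /imsetP[x]; rewrite inE => Fx -> /imsetP[y].
rewrite inE => Fy ->; have [eq_xy disj_xy] := q_trivI Fx Fy.
rewrite -setI_eq0 => neq; apply/eqP/disj_xy.
by apply: contraNN neq => /eq_xy ->.
Qed.

Lemma vertex_multiplicity_le (x : item G) :
  multiplicity vertex_cliques x <= multiplicity QQ x.
Proof.
by apply/subset_leq_card/subsetP=> Q; rewrite !inE => /andP[/andP[_ ->]].
Qed.

(** The assigned clique [q x] is counted on the right but has been removed on the left. *)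
Lemma vertex_multiplicity_lt (x : item G) :
  doubled_or_tripled QQ x -> multiplicity vertex_cliques x < multiplicity QQ x.
Proof.
move=> Fx; apply/proper_card/properP; split.
  by apply/subsetP=> Q; rewrite !inE => /andP[/andP[_ ->]].
exists (q x); first by rewrite inE q_in ?q_belongs.
by rewrite !inE [q x \in _]imset_f ?inE.
Qed.

Lemma vertex_cliques_vertex (v : G) : multiplicity vertex_cliques (inr v) <= 2.
Proof.
have := vertex_le3 v; rewrite leq_eqVlt => /orP[m3|].
  rewrite -ltnS -(eqP m3); apply: vertex_multiplicity_lt.
  by rewrite /= inE.
by rewrite ltnS; apply/leq_trans/vertex_multiplicity_le.
Qed.

Lemma vertex_cliques_edge (e : edge G) : multiplicity vertex_cliques (inl e) <= 1.
Proof.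
have /andP[_] := edge_mult e; rewrite leq_eqVlt => /orP[m2|].
  rewrite -ltnS -(eqP m2); apply: vertex_multiplicity_lt.
  by rewrite /= inE.
by rewrite ltnS; apply/leq_trans/vertex_multiplicity_le.
Qed.

Definition cliques_at (u : G) : {set {set G}} := [set Q in vertex_cliques | u \in Q].

(** The padding vertices [inr (u, i)] carry the name of their owner [u], so no other vertex of [G]
    has them as ends. *)
Definition clique_ends (u : G) : {set {set G} + G * 'I_2} :=
  [set inl Q | Q in cliques_at u] :|:
  [set inr (u, i) | i : 'I_2 & i < 2 - #|cliques_at u|].

Lemma inl_clique_ends (u : G) (Q : {set G}) :
  (inl Q \in clique_ends u) = (Q \in cliques_at u).
Proof.
rewrite in_setU (mem_imset _ _ (@inl_inj _ _)).
by rewrite [X in _ || X](_ : _ = false) ?orbF //; apply/imsetP=> -[].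
Qed.

Lemma inr_clique_ends (u v : G) (i : 'I_2) :
  (inr (v, i) \in clique_ends u) = (v == u) && (i < 2 - #|cliques_at u|).
Proof.
rewrite in_setU [X in X || _](_ : _ = false); last by apply/imsetP=> -[].
apply/imsetP/andP => [[j]|[/eqP-> lti]]; last by exists i; rewrite ?inE.
by rewrite inE => ltj [-> ->].
Qed.

Lemma card_clique_ends (u : G) : #|clique_ends u| = 2.
Proof.
rewrite cardsU (_ : _ :&: _ = set0) ?cards0 ?subn0; last first.
  by apply/setP=> z; rewrite !inE; apply/andP=> -[/imsetP[Q _ ->] /imsetP[]].
rewrite card_imset; last exact: inl_inj.
rewrite card_imset; last by move=> i j [].
rewrite -[RHS](subnKC (vertex_cliques_vertex u)); congr (_ + _).
(* The indices of ['I_2] below the bound are counted one by one; the cases 0, 1, 2 for the number of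
   cliques at [u] remain. *)
rewrite -sum1dep_card big_mkcond /= !big_ord_recl big_ord0 /=.
by have := vertex_cliques_vertex u; rewrite /multiplicity /cliques_at; case: #|_| => [|[|[]]].
Qed.

Lemma comembers_adj (u v : G) (Q : {set G}) :
  u != v -> Q \in QQ -> u \in Q -> v \in Q -> adj u v.
Proof. by move=> uv HQ uQ vQ; apply: (clique HQ uQ vQ). Qed.

(** Distinct vertices with equal ends have no padding, hence lie in the same two vertex cliques.
    They are then adjacent, and their edge lies in two vertex cliques, one too many. *)
Lemma clique_ends_inj : injective clique_ends.
Proof.
move=> u v Euv; apply/eqP/negPn/negP => uv.
have eq_at : cliques_at u = cliques_at v.
  by apply/setP=> Q; rewrite -!inl_clique_ends Euv.
(* Otherwise the padding vertex of [u] with index 0 would also be an end of [v]. *)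
have card2 : #|cliques_at u| >= 2.
  rewrite leqNgt -subn_gt0; apply/negP=> gt0.
  have := inr_clique_ends u u ord0; rewrite Euv inr_clique_ends (negPf uv) eqxx /=.
  by rewrite gt0.
have [Q HQ] : exists Q, Q \in cliques_at u by apply/card_gt0P; apply: ltnW.
have HQv : Q \in cliques_at v by rewrite -eq_at.
have adj_uv : adj u v.
  move: HQ HQv; rewrite !inE => /andP[/andP[_ HQ] uQ] /andP[_ vQ].
  exact: comembers_adj uv HQ uQ vQ.
have e_edge : [set u; v] \in edge_set G by apply/edge_setP; exists u, v.
have := vertex_cliques_edge (exist (fun e => e \in edge_set G) _ e_edge); rewrite leqNgt => /negP; apply.
apply: leq_trans card2 _; apply/subset_leq_card/subsetP=> R HR.
have: R \in cliques_at v by rewrite -eq_at.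
move: HR; rewrite !inE /= => /andP[-> uR] /andP[_ vR].
by rewrite subUset !sub1set uR.
Qed.

(** A vertex outside all color cliques receives itself as a private color. *)
Definition clique_color (u : G) : {set G} + G :=
  if u \in cover color_cliques then inl (pblock color_cliques u) else inr u.

Lemma clique_color_eq (u v : G) :
  u != v ->
  reflect (exists2 Q, Q \in color_cliques & u \in Q /\ v \in Q)
          (clique_color u == clique_color v).
Proof.
move=> uv; apply: (iffP eqP) => [|[Q HQ [uQ vQ]]]; last first.
  have cov w : w \in Q -> w \in cover color_cliques.
    by move=> wQ; apply/bigcupP; exists Q.
  by rewrite /clique_color !cov // !(def_pblock color_cliques_trivI HQ).
rewrite /clique_color; case: ifP => cu; case: ifP => cv //; last first.
  by case=> E; rewrite E eqxx in uv.
case=> E; exists (pblock color_cliques u); first exact: pblock_mem.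
by split; last rewrite E; rewrite mem_pblock.
Qed.

(** Every edge of [G] lies in some member of [QQ]: a color clique gives equal colors, a vertex
    clique a common end. Conversely, distinct vertices with a common end or color lie in a common
    clique. *)
Lemma cliques_represent : represents clique_ends clique_color.
Proof.
split; [exact: clique_ends_inj | exact: card_clique_ends |] => u v.
have [->|uv] /= := eqVneq u v; first by rewrite adj_irrefl.
apply/idP/orP => [adj_uv | [/set0Pn[[Q|[w i]]] | /(clique_color_eq uv)[Q HQ [uQ vQ]]]].
- have e_edge : [set u; v] \in edge_set G by apply/edge_setP; exists u, v.
  have /andP[/card_gt0P[Q]] := edge_mult (exist (fun e => e \in edge_set G) _ e_edge).
  rewrite inE /= subUset !sub1set => /and3P[HQ uQ vQ] _.
  have [QC|QnC] := boolP (Q \in color_cliques).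
    by right; apply/clique_color_eq => //; exists Q.
  left; apply/set0Pn; exists (inl Q).
  by rewrite inE !inl_clique_ends !inE QnC HQ uQ.
- rewrite inE !inl_clique_ends !inE => /andP[/andP[/andP[_ HQ] uQ] /andP[_ vQ]].
  exact: comembers_adj uv HQ uQ vQ.
- rewrite inE !inr_clique_ends => /andP[/andP[/eqP-> _] /andP[/eqP E _]].
  by rewrite E eqxx in uv.
- exact: comembers_adj uv (color_cliques_sub HQ) uQ vQ.
Qed.

End RootOfCliques.

(** * The characterization *)

Theorem theorem3 (G : sgraph) :
  color_line_graph G <->
  exists QQ : {set {set G}},
    [/\ forall Q : {set G}, Q \in QQ -> is_clique Q,
        (forall v : G, multiplicity QQ (inr v) <= 3) /\
        (forall e : edge G, 1 <= multiplicity QQ (inl e) <= 2)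
      & exists (QF : edge G -> {set G}) (QW : G -> {set G}),
        [/\ (forall e : edge G, e \in doubled_edges QQ -> QF e \in QQ) /\
            (forall v : G, v \in tripled_vertices QQ -> QW v \in QQ),
            forall x : item G, doubled_or_tripled QQ x ->
              belongs x (assigned QF QW x)
          & forall x y : item G,
              doubled_or_tripled QQ x -> doubled_or_tripled QQ y ->
              (belongs x (assigned QF QW y) ->
                 assigned QF QW x = assigned QF QW y) /\
              (~~ belongs x (assigned QF QW y) ->
                 assigned QF QW x :&: assigned QF QW y = set0)]].
Proof.
split=> [/color_line_graphP[T [C [ends [c repr]]]] |].
  pose q := color_of_item c; exists (root_cliques ends c); split.
  - exact: root_cliques_clique.
  - split=> [v|e].
      apply: leq_trans (root_multiplicity _ _ _) _.
      exact: leq_add (star_vertex_multiplicity repr v) (color_multiplicity _ _).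
    rewrite (root_edge_covered repr) /=.
    apply: leq_trans (root_multiplicity _ _ _) _.
    exact: leq_add (star_edge_multiplicity repr e) (color_multiplicity _ _).
  have qP := color_of_itemP repr.
  exists (fun e => q (inl e)), (fun v => q (inr v)).
  have qE x : assigned (fun e => q (inl e)) (fun v => q (inr v)) x = q x by case: x.
  split=> [|x Fx|x y Fx Fy]; rewrite ?qE.
  - by split=> x Fx; rewrite inE; apply/orP; right;
      [have /andP[] := qP (inl x) Fx | have /andP[] := qP (inr x) Fx].
  - by have /andP[] := qP x Fx.
  - have [/andP[qx xx] /andP[qy _]] := (qP x Fx, qP y Fy); split=> [xy|].
      have [u xu] := belongs_nonempty x.
      exact: color_classes_disjoint qx qy (xu _ xx) (xu _ xy).
    (* A common vertex makes the two color classes equal, and then [x] belongs to [q y]. *)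
    apply: contraNeq => /set0Pn[u /setIP[ux uy]].
    by rewrite -[q y](color_classes_disjoint qx qy ux uy).
case=> QQ [clique [v3 e2] [QF [QW [[QFin QWin] b1 b2]]]].
(* The witnesses are fixed by unification with [cliques_represent], taken at
   [q := assigned QF QW]. *)
apply/color_line_graphP; do 4 eexists.
apply: (cliques_represent clique v3 e2 _ b1 b2).
by case=> [e|v]; [apply: QFin | apply: QWin].
Qed.
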